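(* Let $\varphi\colon \mathcal{H}_0\to\mathbb{C}$ be a Shapovalov-regular linear functional and put $q:=\omega_1\varphi(c)$. For a partition $\lambda$ let $m_k(\lambda)$ be the number of parts equal to $k$, $z_\lambda:=\prod_{k\ge1}k^{m_k(\lambda)}\,m_k(\lambda)!$, and $\ell(\lambda):=\sum_k m_k(\lambda)$. For $n\ge0$ let $\mu_n\colon M(\varphi)[-n]\to\mathbb{C}$ be the linear functional with $\mu_n(b_{-\lambda}v_\varphi)=1$ for every $\lambda\vdash n$. (i) For every $n\ge 0$ and every nonzero scalar $\kappa_n$ there is a unique vector $\tilde P_n\in M(\varphi)[-n]$ with $\mathcal{S}_\varphi(\tilde P_n,w)=\kappa_n\,\mu_n(w)$ for all $w\in M(\varphi)[-n]$ (so $\tilde P_n$ exists and is unique up to the scalar $\kappa_n$), and it has the closed form $$\tilde P_n=\kappa_n'\sum_{\lambda\vdash n}\frac{1}{z_\lambda\,q^{\ell(\lambda)}}\;b_{-\lambda}v_\varphi$$ for a nonzero scalar $\kappa_n'$. (ii) $\mathcal{S}_\varphi(\tilde P_n,\tilde P_{n'})=0$ for $n\ne n'$. (iii) With $\kappa_n'=1$ in the closed form of (i), one has $$\mathcal{S}_\varphi(\tilde P_n,\tilde P_n)=\sum_{\lambda\vdash n}\frac{1}{z_\lambda\,q^{\ell(\lambda)}}=\binom{q^{-1}+n-1}{n}=\frac{1}{n!}\prod_{j=1}^{n-1}(1+jq)\cdot q^{-n}.$$ (iv) Assume in addition that $q\in\mathbb{R}_{>0}$. Then for $n\ge1$ the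 value $\kappa_n'=\bigl(\tfrac{2}{2n+1}\bigr)^{1/2}\binom{q^{-1}+n-1}{n}^{-1/2}$ is the unique positive scalar for which $$\mathcal{S}_\varphi(\tilde P_n,\tilde P_{n'})=\frac{2}{2n+1}\,\delta_{nn'},\qquad n,n'\ge1,$$ the right-hand side being the squared norms on $[-1,1]$ of the Legendre polynomials $P_n$ defined by $(1-2at+t^2)^{-1/2}=\sum_{n\ge0}P_n(a)t^n$.
   Context: $\mathcal{H}=\mathcal{H}_2$ denotes the complex Lie algebra with basis $\{b_k:k\in\mathbb{Z}\}\cup\{c\}$, with $c$ central and $[b_k,b_l]=k\,\delta_{k+l,0}\,\omega_1\,c$, where $\omega_1>0$ is a fixed real constant. (It is the Heisenberg subalgebra attached to the genus-zero curve $u^2=1-2at+t^2$, the case $m=2$, $r=1$; only these brackets are used.) Put $\mathcal{H}_+=\bigoplus_{k>0}\mathbb{C}b_k$, $\mathcal{H}_0=\mathbb{C}b_0\oplus\mathbb{C}c$, $\mathcal{H}_-=\bigoplus_{k<0}\mathbb{C}b_k$. For a linear functional $\varphi\colon\mathcal{H}_0\to\mathbb{C}$, the Verma module is $M(\varphi)=U(\mathcal{H})\otimes_{U(\mathcal{H}_+\oplus\mathcal{H}_0)}\mathbb{C}_\varphi$, where $\mathbb{C}_\varphi$ is one-dimensional, $b_k$ ($k>0$) acts by $0$, and $b_0$, $c$ act by $\varphi(b_0)$, $\varphi(c)$; $v_\varphi$ is the image of $1$. For a partition $\lambda=(\lambda_1\ge\dots\ge\lambda_s>0)$ write $b_{-\lambda}v_\varphi:=b_{-\lambda_1}\cdots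 b_{-\lambda_s}v_\varphi$. These vectors form a basis of $M(\varphi)$; $M(\varphi)[-n]$ is the span of those with $\lambda\vdash n$. Let $\omega$ be the anti-automorphism of $U(\mathcal{H})$ with $\omega(b_k)=b_{-k}$, $\omega(c)=c$. The Shapovalov form $\mathcal{S}_\varphi$ is the unique symmetric bilinear form on $M(\varphi)$ with $\mathcal{S}_\varphi(v_\varphi,v_\varphi)=1$, $\mathcal{S}_\varphi(xv,w)=\mathcal{S}_\varphi(v,\omega(x)w)$ for $x\in U(\mathcal{H})$, and $\mathcal{S}_\varphi(M(\varphi)[-n],M(\varphi)[-n'])=0$ for $n\ne n'$. Let $G_n$ be its Gram matrix on $M(\varphi)[-n]$ in the basis $\{b_{-\lambda}v_\varphi:\lambda\vdash n\}$. The functional $\varphi$ is Shapovalov-regular if $\det(G_n)\ne0$ for every $n\ge1$. *)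

(* Defs.v *)
From HB Require Import structures.
From mathcomp Require Import all_boot all_order all_algebra.
From mathcomp Require Import all_classical all_reals all_analysis.
From mathcomp Require Import complex finmap.
(* The notations of monalg clash with those of MathComp-Analysis. *)
From mathcomp Require Export -(notations) monalg.
Set Implicit Arguments.
Unset Strict Implicit.
Unset Printing Implicit Defensive.
Import Order.TTheory GRing.Theory Num.Theory.
Import numFieldNormedType.Exports.
Local Open Scope classical_set_scope.
Local Open Scope ring_scope.
Local Open Scope quotient_scope.
Local Open Scope complex_scope.

(* Locks the operations of the quotients below, which unification would *)
(* otherwise unfold.                                                    *)
Fact quot_key : unit. Proof. exact: tt. Qed.

Inductive heis_gen := HeisB of int | HeisC.

Definition heis_gen_code (g : heis_gen) : option int :=
  if g is HeisB k then Some k else None.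
Definition heis_gen_decode (o : option int) : heis_gen :=
  if o is Some k then HeisB k else HeisC.
Lemma heis_gen_codeK : cancel heis_gen_code heis_gen_decode.
Proof. by case. Qed.
HB.instance Definition _ := Countable.copy heis_gen (can_type heis_gen_codeK).

Section RMorphismAux.
Context (A B : nzRingType) (f : {rmorphism A -> B}).

Fact rmorph_sub0 x y : f x = 0 -> f y = 0 -> f (x - y) = 0.
Proof. by move=> fx fy; rewrite rmorphB fx fy subr0. Qed.
Fact rmorph_mul0 a b x : f x = 0 -> f (a * x * b) = 0.
Proof. by move=> fx; rewrite !rmorphM fx mulr0 mul0r. Qed.
Fact rmorph_comm0 x y z :
  f x = 0 -> f y = 0 -> f z = 0 -> f (x * y - y * x - z) = 0.
Proof. by move=> fx fy fz; rewrite !rmorphB !rmorphM fx fy fz mulr0 !subr0. Qed.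
Fact rmorph_comm x y : f (x * y - y * x) = f x * f y - f y * f x.
Proof. by rewrite rmorphB !rmorphM. Qed.

End RMorphismAux.

(* ------------------------------------------------------------------ *)
Section LieAlgebra.
Context (R : realType).
Local Notation C := R[i].

(* Finitely supported functions [heis_gen -> C]: the free vector space *)
(* on the b_k and c.                                                   *)
Definition heis := malg heis_gen C.
HB.instance Definition _ := GRing.Lmodule.on heis.

Definition heis_basis (g : heis_gen) : heis := mkmalgU g 1.

Definition heis_b (k : int) : heis := heis_basis (HeisB k).
Definition heis_c : heis := heis_basis HeisC.

Definition heis_gen_bracket (w1 : R) (g h : heis_gen) : heis :=
  match g, h with
  | HeisB k, HeisB l => (k%:~R * (k + l == 0)%:R * w1%:C) *: heis_c
  | _, _ => 0
  end.

Definition heis_bracket (w1 : R) (x y : heis) : heis :=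
  \sum_(g <- msupp x) \sum_(h <- msupp y)
     (mcoeff g x * mcoeff h y) *: heis_gen_bracket w1 g h.

Definition heis0_pred : {pred heis} :=
  fun x => `[< forall k : int, k != 0 -> mcoeff (HeisB k) x = 0 >].

Fact heis0_submod_closed : submod_closed heis0_pred.
Proof.
split; first by apply/asboolP => k _; rewrite mcoeff0.
move=> a x y /asboolP hx /asboolP hy; apply/asboolP => k hk.
by rewrite mcoeffD mcoeffZ hx // hy // mulr0 addr0.
Qed.
HB.instance Definition _ :=
  GRing.isSubmodClosed.Build C heis heis0_pred heis0_submod_closed.

Definition heis0 := {x : heis | x \in heis0_pred}.
HB.instance Definition _ := SubChoice.on heis0.
HB.instance Definition _ := [SubChoice_isSubLmodule of heis0 by <:].

Fact heis_b0_in : heis_b 0 \in heis0_pred.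
Proof.
apply/asboolP => k hk; rewrite mcoeffU.
by case: eqP => // -[] /eqP; rewrite eq_sym (negPf hk).
Qed.
Fact heis_c_in : heis_c \in heis0_pred.
Proof. by apply/asboolP => k hk; rewrite mcoeffU. Qed.

Definition heis0_b : heis0 := exist (fun x => x \in heis0_pred) _ heis_b0_in.
Definition heis0_c : heis0 := exist (fun x => x \in heis0_pred) _ heis_c_in.

(* The tensor algebra of [heis]: the free associative algebra on its   *)
(* basis, i.e. the algebra of the free monoid of words.                *)
Definition heis_tensor := malg (fmonom heis_gen) C.
HB.instance Definition _ := GRing.Lalgebra.on heis_tensor.

Definition heis_tensor_of (x : heis) : heis_tensor :=
  \sum_(g <- msupp x) mcoeff g x *: (mkmalgU (fmu g) 1 : heis_tensor).

Fact heis_tensor_scaleAr (a : C) (x y : heis_tensor) :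
  a *: (x * y) = x * (a *: y).
Proof.
have comm (z : heis_tensor) : z * mkmalgU mone a = mkmalgU mone a * z.
  rewrite !malgM_def fgmulgU fgmulUg; apply: eq_bigr => k _.
  by rewrite mulm1 mul1m mulrC.
by rewrite -!mul_malgC !mulrA comm.
Qed.
HB.instance Definition _ :=
  GRing.Lalgebra_isAlgebra.Build C heis_tensor heis_tensor_scaleAr.

End LieAlgebra.

(* ------------------------------------------------------------------ *)
Section EnvelopingAlgebra.
Context (R : realType) (w1 : R).
Local Notation C := R[i].
Local Notation T := (heis_tensor R).
Local Notation iota := (@heis_tensor_of R).

(* The two-sided ideal of the tensor algebra generated by the elements *)
(* x (x) y - y (x) x - [x, y].                                         *)
Inductive in_lie_ideal : T -> Prop :=
| lie_ideal_rel x y :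
    in_lie_ideal (iota x * iota y - iota y * iota x
                    - iota (heis_bracket w1 x y))
| lie_ideal0 : in_lie_ideal 0
| lie_idealB x y : in_lie_ideal x -> in_lie_ideal y -> in_lie_ideal (x - y)
| lie_idealM a x b : in_lie_ideal x -> in_lie_ideal (a * x * b).

Definition lie_ideal : {pred T} := fun x => `[< in_lie_ideal x >].

Fact lie_ideal_zmod_closed : zmod_closed lie_ideal.
Proof.
split; first exact/asboolP/lie_ideal0.
by move=> x y /asboolP hx /asboolP hy; apply/asboolP/lie_idealB.
Qed.
HB.instance Definition _ :=
  GRing.isZmodClosed.Build T lie_ideal lie_ideal_zmod_closed.

Fact lie_idealMl a x : x \in lie_ideal -> a * x \in lie_ideal.
Proof.
by move=> /asboolP hx; rewrite -[a * x]mulr1; apply/asboolP/lie_idealM.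
Qed.
Fact lie_idealMr a x : x \in lie_ideal -> x * a \in lie_ideal.
Proof.
by move=> /asboolP hx; rewrite -[x in x * a]mul1r; apply/asboolP/lie_idealM.
Qed.

Definition uea := Quotient.quot lie_ideal.
HB.instance Definition _ := Choice.on uea.
HB.instance Definition _ := GRing.Zmodule.on uea.

Definition uea_pi (x : T) : uea := \pi_uea x.

Fact uea_piE x y : (uea_pi x = uea_pi y) <-> (x - y \in lie_ideal).
Proof.
rewrite /uea_pi; split=> [h|h].
  by rewrite Quotient.idealrBE h.
by apply/eqP; rewrite -Quotient.idealrBE.
Qed.

Fact uea_piB : zmod_morphism uea_pi.
Proof. by move=> x y; rewrite /uea_pi !piE. Qed.
HB.instance Definition _ := GRing.isZmodMorphism.Build T uea uea_pi uea_piB.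

Fact uea_reprK x : uea_pi (repr x) = x.
Proof. exact: reprK. Qed.

Definition uea_one : uea := uea_pi 1.
Definition uea_mul : uea -> uea -> uea :=
  locked_with quot_key (fun x y => uea_pi (repr x * repr y)).
Definition uea_scale : C -> uea -> uea :=
  locked_with quot_key (fun a x => uea_pi (a *: repr x)).

Fact uea_pi_mul x y : uea_pi (x * y) = uea_mul (uea_pi x) (uea_pi y).
Proof.
rewrite /uea_mul locked_withE; apply/uea_piE; set x' := repr _; set y' := repr _.
have -> : x * y - x' * y' = x * (y - y') + (x - x') * y'.
  by rewrite mulrBr mulrBl addrA subrK.
by apply: rpredD; [apply: lie_idealMl | apply: lie_idealMr];
  apply/uea_piE; rewrite uea_reprK.
Qed.

Fact uea_pi_scale a x : uea_pi (a *: x) = uea_scale a (uea_pi x).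
Proof.
rewrite /uea_scale locked_withE.
apply/uea_piE; rewrite -scalerBr -[_ - _]mul1r scalerAl.
by apply: lie_idealMl; apply/uea_piE; rewrite uea_reprK.
Qed.

Fact uea_mulA : associative uea_mul.
Proof.
move=> x y z; rewrite -[x]uea_reprK -[y]uea_reprK -[z]uea_reprK.
by rewrite -!uea_pi_mul mulrA.
Qed.
Fact uea_mul1 : left_id uea_one uea_mul.
Proof. by move=> x; rewrite -[x]uea_reprK -uea_pi_mul mul1r. Qed.
Fact uea_1mul : right_id uea_one uea_mul.
Proof. by move=> x; rewrite -[x]uea_reprK -uea_pi_mul mulr1. Qed.
Fact uea_mulDl : left_distributive uea_mul +%R.
Proof.
move=> x y z; rewrite -[x]uea_reprK -[y]uea_reprK -[z]uea_reprK.
by rewrite -raddfD -!uea_pi_mul mulrDl raddfD.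
Qed.
Fact uea_mulDr : right_distributive uea_mul +%R.
Proof.
move=> x y z; rewrite -[x]uea_reprK -[y]uea_reprK -[z]uea_reprK.
by rewrite -raddfD -!uea_pi_mul mulrDr raddfD.
Qed.

(* The counit kills the ideal, so the enveloping algebra is nonzero. *)
Fact uea_one_neq0 : uea_one != 0.
Proof.
apply/eqP; rewrite -(raddf0 uea_pi) => /uea_piE; rewrite subr0 => /asboolP h.
pose eps : {rmorphism T -> C} := mcoeff (mone : fmonom heis_gen).
suff eps0 (x : T) : in_lie_ideal x -> eps x = 0.
  by move/eqP: (eps0 _ h); rewrite rmorph1 oner_eq0.
have iota0 y : eps (iota y) = 0.
  rewrite raddf_sum big1 // => g _ /=; rewrite mcoeffZ mcoeffU1.
  suff -> : (fmu g == mone) = false by rewrite mulr0.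
  by apply/negP => /eqP/(congr1 (@fmonom_val _)); rewrite fm1 fmuE.
elim=> {x} [x y||x y _ hx _ hy|a x b _ hx].
- exact: (rmorph_comm0 (iota0 x) (iota0 y) (iota0 (heis_bracket w1 x y))).
- exact: (raddf0 eps).
- exact: (rmorph_sub0 hx hy).
- exact: (rmorph_mul0 a b hx).
Qed.

HB.instance Definition _ := GRing.Zmodule_isNzRing.Build uea
  uea_mulA uea_mul1 uea_1mul uea_mulDl uea_mulDr uea_one_neq0.

Fact uea_scaleA a b x : uea_scale a (uea_scale b x) = uea_scale (a * b) x.
Proof. by rewrite -[x]uea_reprK -!uea_pi_scale scalerA. Qed.
Fact uea_scale1 : left_id 1 uea_scale.
Proof. by move=> x; rewrite -[x]uea_reprK -uea_pi_scale scale1r. Qed.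
Fact uea_scaleDr : right_distributive uea_scale +%R.
Proof.
move=> a x y; rewrite -[x]uea_reprK -[y]uea_reprK.
by rewrite -raddfD -!uea_pi_scale scalerDr raddfD.
Qed.
Fact uea_scaleDl x : {morph uea_scale^~ x : a b / a + b}.
Proof.
by move=> a b; rewrite -[x]uea_reprK -!uea_pi_scale scalerDl raddfD.
Qed.
HB.instance Definition _ := GRing.Zmodule_isLmodule.Build C uea
  uea_scaleA uea_scale1 uea_scaleDr uea_scaleDl.

Fact uea_scaleAl a (x y : uea) : a *: (x * y) = (a *: x) * y.
Proof.
rewrite -[x]uea_reprK -[y]uea_reprK.
change (uea_scale a (uea_mul (uea_pi (repr x)) (uea_pi (repr y))) =
  uea_mul (uea_scale a (uea_pi (repr x))) (uea_pi (repr y))).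
by rewrite -uea_pi_mul -!uea_pi_scale -uea_pi_mul scalerAl.
Qed.
HB.instance Definition _ := GRing.Lmodule_isLalgebra.Build C uea uea_scaleAl.

Fact uea_scaleAr a (x y : uea) : a *: (x * y) = x * (a *: y).
Proof.
rewrite -[x]uea_reprK -[y]uea_reprK.
change (uea_scale a (uea_mul (uea_pi (repr x)) (uea_pi (repr y))) =
  uea_mul (uea_pi (repr x)) (uea_scale a (uea_pi (repr y)))).
by rewrite -uea_pi_mul -!uea_pi_scale -uea_pi_mul scalerAr.
Qed.
HB.instance Definition _ := GRing.Lalgebra_isAlgebra.Build C uea uea_scaleAr.

HB.instance Definition _ := GRing.isMonoidMorphism.Build T uea uea_pi
  (conj (erefl : uea_pi 1 = 1) uea_pi_mul).
HB.instance Definition _ := GRing.isScalable.Build C T uea *:%R uea_pi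
  uea_pi_scale.

Definition uea_of (x : heis R) : uea := uea_pi (iota x).

Fact uea_of_bracket x y :
  uea_of x * uea_of y - uea_of y * uea_of x = uea_of (heis_bracket w1 x y).
Proof.
apply: etrans (esym (rmorph_comm uea_pi (iota x) (iota y))) _.
exact/uea_piE/asboolP/lie_ideal_rel.
Qed.

Definition uea_b (k : int) : uea := uea_of (heis_b R k).
Definition uea_c : uea := uea_of (heis_c R).

Record heis_antiautomorphism (omega : uea -> uea) : Prop := {
  antiaut_bij : bijective omega;
  antiaut_linear : forall a x y, omega (a *: x + y) = a *: omega x + omega y;
  antiaut_1 : omega 1 = 1;
  antiaut_mul : forall x y, omega (x * y) = omega y * omega x;
  antiaut_b : forall k, omega (uea_b k) = uea_b (- k);
  antiaut_c : omega uea_c = uea_c }.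

End EnvelopingAlgebra.

(* ------------------------------------------------------------------ *)
Section Verma.
Context (R : realType) (w1 : R) (phi : {scalar heis0 R}).
Local Notation C := R[i].
Local Notation U := (uea w1).

(* [borel_acts x a]: x lies in the subalgebra U(H_+ (+) H_0) of U(H)    *)
(* and acts on the one-dimensional module C_phi as the scalar a.        *)
Inductive borel_acts : U -> C -> Prop :=
| borel_acts_pos (k : int) : 0 < k -> borel_acts (uea_b w1 k) 0
| borel_acts_zero (h : heis0 R) : borel_acts (uea_of w1 (val h)) (phi h)
| borel_acts1 : borel_acts 1 1
| borel_actsD x a y b :
    borel_acts x a -> borel_acts y b -> borel_acts (x + y) (a + b)
| borel_actsZ c x a : borel_acts x a -> borel_acts (c *: x) (c * a)
| borel_actsM x a y b :
    borel_acts x a -> borel_acts y b -> borel_acts (x * y) (a * b).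

(* Identifying u (x) z in U(H) (x)_C C_phi with z u, the tensor product *)
(* over U(H_+ (+) H_0) is the quotient of U(H) by the span of the       *)
(* u x (x) 1 - u (x) x.1 = u x - a u.                                   *)
Inductive in_verma_rel : U -> Prop :=
| verma_rel_tens u x a : borel_acts x a -> in_verma_rel (u * x - a *: u)
| verma_rel0 : in_verma_rel 0
| verma_relB x y : in_verma_rel x -> in_verma_rel y -> in_verma_rel (x - y).

Definition verma_rel : {pred U} := fun x => `[< in_verma_rel x >].

Fact verma_rel_zmod_closed : zmod_closed verma_rel.
Proof.
split; first exact/asboolP/verma_rel0.
by move=> x y /asboolP hx /asboolP hy; apply/asboolP/verma_relB.
Qed.
HB.instance Definition _ :=
  GRing.isZmodClosed.Build U verma_rel verma_rel_zmod_closed.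

Fact verma_relMl (u x : U) : x \in verma_rel -> u * x \in verma_rel.
Proof.
move=> /asboolP hx; apply/asboolP; elim: hx => {x} [v x a hx||x y _ hx _ hy].
- by rewrite mulrBr mulrA -scalerAr; apply: verma_rel_tens.
- by rewrite mulr0; apply: verma_rel0.
- by rewrite mulrBr; apply: verma_relB.
Qed.

Definition verma := Quotient.quot verma_rel.
HB.instance Definition _ := Choice.on verma.
HB.instance Definition _ := GRing.Zmodule.on verma.

Definition verma_pi (x : U) : verma := \pi_verma x.

Fact verma_piE x y : (verma_pi x = verma_pi y) <-> (x - y \in verma_rel).
Proof.
rewrite /verma_pi; split=> [h|h].
  by rewrite Quotient.idealrBE h.
by apply/eqP; rewrite -Quotient.idealrBE.
Qed.

Fact verma_piB : zmod_morphism verma_pi.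
Proof. by move=> x y; rewrite /verma_pi !piE. Qed.
HB.instance Definition _ := GRing.isZmodMorphism.Build U verma verma_pi verma_piB.

Fact verma_reprK v : verma_pi (repr v) = v.
Proof. exact: reprK. Qed.

Definition verma_act : U -> verma -> verma :=
  locked_with quot_key (fun x v => verma_pi (x * repr v)).
Definition verma_scale : C -> verma -> verma :=
  locked_with quot_key (fun a v => verma_pi (a *: repr v)).

Fact verma_pi_act x y : verma_act x (verma_pi y) = verma_pi (x * y).
Proof.
rewrite /verma_act locked_withE.
apply/verma_piE; rewrite -mulrBr; apply: verma_relMl.
by apply/verma_piE; rewrite verma_reprK.
Qed.
Fact verma_pi_scale a x : verma_pi (a *: x) = verma_scale a (verma_pi x).
Proof.
rewrite /verma_scale locked_withE.
apply/verma_piE; rewrite -scalerBr -[_ - _]mul1r scalerAl.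
by apply: verma_relMl; apply/verma_piE; rewrite verma_reprK.
Qed.

Fact verma_scaleA a b v : verma_scale a (verma_scale b v) = verma_scale (a * b) v.
Proof. by rewrite -[v]verma_reprK -!verma_pi_scale scalerA. Qed.
Fact verma_scale1 : left_id 1 verma_scale.
Proof. by move=> v; rewrite -[v]verma_reprK -verma_pi_scale scale1r. Qed.
Fact verma_scaleDr : right_distributive verma_scale +%R.
Proof.
move=> a v w; rewrite -[v]verma_reprK -[w]verma_reprK.
by rewrite -raddfD -!verma_pi_scale scalerDr raddfD.
Qed.
Fact verma_scaleDl v : {morph verma_scale^~ v : a b / a + b}.
Proof.
by move=> a b; rewrite -[v]verma_reprK -!verma_pi_scale scalerDl raddfD.
Qed.
HB.instance Definition _ := GRing.Zmodule_isLmodule.Build C verma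
  verma_scaleA verma_scale1 verma_scaleDr verma_scaleDl.

Fact verma_actM x y v : verma_act (x * y) v = verma_act x (verma_act y v).
Proof. by rewrite -[v]verma_reprK !verma_pi_act mulrA. Qed.
Fact verma_act1 v : verma_act 1 v = v.
Proof. by rewrite -[v]verma_reprK !verma_pi_act mul1r. Qed.
Fact verma_act_linear x a v w :
  verma_act x (a *: v + w) = a *: verma_act x v + verma_act x w.
Proof.
rewrite -[v]verma_reprK -[w]verma_reprK.
rewrite -[a *: verma_pi (repr v)]/(verma_scale _ _) -verma_pi_scale -raddfD /=.
rewrite !verma_pi_act -[a *: verma_pi (x * _)]/(verma_scale _ _).
by rewrite -verma_pi_scale -raddfD /= mulrDr scalerAr.
Qed.
Fact verma_actDl x y v : verma_act (x + y) v = verma_act x v + verma_act y v.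
Proof. by rewrite -[v]verma_reprK !verma_pi_act mulrDl raddfD. Qed.
Fact verma_actZl a x v : verma_act (a *: x) v = a *: verma_act x v.
Proof.
rewrite -[v]verma_reprK !verma_pi_act -[RHS]/(verma_scale _ _).
by rewrite -verma_pi_scale -scalerAl.
Qed.

Definition verma_vec : verma := verma_pi 1.

Fact verma_vec_acts x a : borel_acts x a -> verma_act x verma_vec = a *: verma_vec.
Proof.
move=> xa; rewrite /verma_vec verma_pi_act -[RHS]/(verma_scale _ _).
rewrite -verma_pi_scale; apply/verma_piE/asboolP.
by rewrite mulr1 -[x in x - _]mul1r; apply: verma_rel_tens.
Qed.

End Verma.

(* ------------------------------------------------------------------ *)
Definition is_partition (n : nat) (s : seq nat) : bool :=
  [&& sorted geq s, all (leq 1) s & sumn s == n].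

(* A partition of n has at most n parts, each of them at most n. *)
Definition partition_of (n : nat) :=
  {s : n.-bseq 'I_n.+1 | is_partition n (map val s)}.
HB.instance Definition _ n := Finite.on (partition_of n).

Definition parts n (l : partition_of n) : seq nat := map val (val (val l)).

Definition mult (k : nat) (s : seq nat) : nat := count_mem k s.

(* The parts of s are at most [sumn s], so that larger k contribute 1  *)
(* to the product and 0 to the sum.                                    *)
Definition zpart (s : seq nat) : nat :=
  \prod_(1 <= k < (sumn s).+1) (k ^ mult k s * (mult k s)`!)%N.
Definition lenpart (s : seq nat) : nat :=
  \sum_(1 <= k < (sumn s).+1) mult k s.

Definition gbinom (F : fieldType) (x : F) (n : nat) : F :=
  (\prod_(i < n) (x - i%:R)) / n`!%:R.

(* ------------------------------------------------------------------ *)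
Section Shapovalov.
Context (R : realType) (w1 : R) (phi : {scalar heis0 R}).
Local Notation C := R[i].
Local Notation M := (verma w1 phi).

Definition verma_b n (l : partition_of n) : M :=
  verma_act (\prod_(k <- parts l) uea_b w1 (- k%:Z)) (verma_vec w1 phi).

Definition in_degree (n : nat) (v : M) : Prop :=
  exists a : partition_of n -> C, v = \sum_l a l *: verma_b l.

Record shapovalov_form (omega : uea w1 -> uea w1) (S : M -> M -> C) : Prop := {
  shapovalov_linear : forall a u v w, S (a *: u + v) w = a * S u w + S v w;
  shapovalov_sym : forall v w, S v w = S w v;
  shapovalov_vec : S (verma_vec w1 phi) (verma_vec w1 phi) = 1;
  shapovalov_contra : forall x v w,
    S (verma_act x v) w = S v (verma_act (omega x) w);
  shapovalov_degree : forall n n' v w, n <> n' ->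
    in_degree n v -> in_degree n' w -> S v w = 0 }.

Definition shapovalov_gram (S : M -> M -> C) (n : nat) :
    'M[C]_#|{: partition_of n}| :=
  \matrix_(i, j) S (verma_b (enum_val i)) (verma_b (enum_val j)).

Definition shapovalov_regular (S : M -> M -> C) : Prop :=
  forall n, (1 <= n)%N -> \det (shapovalov_gram S n) != 0.

(* The linear functional on M[-n] with value 1 on the b_{-lambda} v;    *)
(* values of [mu] outside M[-n] are irrelevant.                         *)
Record partition_functional (n : nat) (mu : M -> C) : Prop := {
  mu_linear : forall a v w, in_degree n v -> in_degree n w ->
    mu (a *: v + w) = a * mu v + mu w;
  mu_b : forall l : partition_of n, mu (verma_b l) = 1 }.

Definition represents (S : M -> M -> C) (mu : M -> C) n (kappa : C) (P : M) :=
  in_degree n P /\ forall w, in_degree n w -> S P w = kappa * mu w.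

Definition level : C := w1%:C * phi (heis0_c R).

Definition ptilde (n : nat) (kappa' : C) : M :=
  kappa' *: \sum_(l : partition_of n)
    ((zpart (parts l))%:R * level ^+ lenpart (parts l))^-1 *: verma_b l.

End Shapovalov.

(* Convergence is required for t near 0 only (depending on a), which    *)
(* already determines the polynomials.                                  *)
Definition legendre_family (R : realType) (P : nat -> {poly R}) : Prop :=
  forall a : R, -1 <= a <= 1 -> \forall t \near (0 : R),
    series (fun n => (P n).[a] * t ^+ n) @ \oo -->
      (1 - 2 * a * t + t ^+ 2) `^ (- 2^-1).

(* Main.v *)
(* On monomials, b_k (k > 0) acts as k q times the derivation with respect   *)
(* to b_(-k), and b_(-k) is its adjoint; hence the monomials b_(-lambda) v   *)
(* are orthogonal with squared norm z_lambda q^l(lambda). A vector           *)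
(* representing kappa mu_n therefore has coefficients                       *)
(* kappa / (z_lambda q^l(lambda)), and regularity in degree 1 gives q != 0.  *)
(* The sum of the x^l(lambda) / z_lambda over the partitions of n is a       *)
(* cycle index H_n: removing a part gives n H_n = x (H_0 + .. + H_(n-1)),    *)
(* hence the binomial coefficient.                                          *)
(* The Legendre generating function satisfies (1 - 2at + t^2) f' = (a - t) f, *)
(* which yields the three-term recurrence, the Legendre differential        *)
(* equation, orthogonality by the Sturm-Liouville argument, and the norms.  *)
Require Import Defs.
From HB Require Import structures.
From mathcomp Require Import all_boot all_order all_algebra.
From mathcomp Require Import all_classical all_reals all_analysis.
From mathcomp Require Import complex finmap.
From mathcomp Require Import zify ring lra.
Set Implicit Arguments.
Unset Strict Implicit.
Unset Printing Implicit Defensive.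
Import Order.TTheory GRing.Theory Num.Theory.
Import numFieldNormedType.Exports.
Local Open Scope classical_set_scope.
Local Open Scope ring_scope.
Local Open Scope complex_scope.

(** * Partitions and the cycle index *)

(** In the monomial basis every Gram matrix is diagonal ([shapovalov_verma_b]), so a vector
    representing a functional has as coefficients the values of that functional divided by the
    squared norms. [represents_ptilde] thus yields existence, uniqueness and the closed form at
    once, with kappa' = kappa. The self-pairing with kappa' = 1 is the sum of the inverse squared
    norms, which is the cycle index of the symmetric group with all variables equal to 1/q, and
    [cycle_sumE] sums it. When q > 0 this value is positive, so normalising amounts to taking a
    positive square root.

    On the Legendre side, analysis is confined to two places: [legendre_series_recurrence] compares
    coefficients in the differential equation of the generating function at a fixed a, and
    [integral_poly] identifies the Lebesgue integral with the formal integral [symint]. Between them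
    everything is polynomial algebra derived from the three-term recurrence, ending in
    [legendre_norm]. *)

Fixpoint zpart_rec (s : seq nat) : nat :=
  if s is k :: s' then (k * (count_mem k s').+1 * zpart_rec s')%N else 1%N.

Lemma is_partition_all n s : is_partition n s -> all (leq 1) s.
Proof. by case/and3P. Qed.

Lemma partsP n (l : partition_of n) : is_partition n (parts l).
Proof. by case: l. Qed.

Lemma parts_inj n : injective (@parts n).
Proof. by move=> l l' /(inj_map val_inj)/val_inj/val_inj. Qed.

Lemma is_partition_perm_eq n n' s t :
  is_partition n s -> is_partition n' t -> perm_eq s t -> s = t.
Proof.
move=> /and3P[ss _ _] /and3P[st _ _].
have geq_tr : transitive geq.
  by move=> x y z /= yx zy; apply: leq_trans zy yx.
have geq_anti : antisymmetric geq.
  by move=> x y /=; rewrite andbC -eqn_leq => /eqP.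
exact: (sorted_eq geq_tr geq_anti ss st).
Qed.

Lemma mem_leq_sumn s k : k \in s -> (k <= sumn s)%N.
Proof. by move=> ks; rewrite (perm_sumn (perm_to_rem ks)) leq_addr. Qed.

Lemma size_leq_sumn s : all (leq 1) s -> (size s <= sumn s)%N.
Proof. by elim: s => //= k s IHs /andP[k0 /IHs]; lia. Qed.

Lemma parts_surj n s : is_partition n s -> exists l : partition_of n, parts l = s.
Proof.
move=> sP; have /and3P[_ s0 /eqP sn] := sP.
pose s' : seq 'I_n.+1 := map inord s.
have s's : map val s' = s.
  rewrite -map_comp map_id_in // => k ks /=.
  by rewrite inordK // ltnS -sn mem_leq_sumn.
have sz : (size s' <= n)%N by rewrite size_map -sn size_leq_sumn.
have bP : is_partition n (map val (Bseq sz)) by rewrite /= s's.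
by exists (exist (fun s : n.-bseq 'I_n.+1 => is_partition n (map val s)) _ bP).
Qed.

(** Plain sequences, so that partitions of different n live in one type and sums over them can be
    reindexed. *)
Definition partitions n : seq (seq nat) := [seq parts l | l : partition_of n].

Lemma mem_partitions n s : (s \in partitions n) = is_partition n s.
Proof.
apply/fintype.imageP/idP => [[l _ ->]|/parts_surj[l <-]]; first exact: partsP.
by exists l.
Qed.

Lemma partitions_uniq n : uniq (partitions n).
Proof. by rewrite map_inj_uniq ?enum_uniq //; apply: parts_inj. Qed.

(** Deleting one copy of k is a bijection; its inverse inserts k and sorts again. *)
Lemma perm_partitions_mem n k : (1 <= k <= n)%N ->
  perm_eq [seq s <- partitions n | k \in s]
          [seq sort geq (k :: s) | s <- partitions (n - k)].
Proof.
move=> /andP[k0 kn].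
have geq_total : total geq by move=> x y /=; rewrite leq_total.
have sort_inj : {in partitions (n - k) &, injective (fun s => sort geq (k :: s))}.
  move=> s t; rewrite !mem_partitions => sP tP E.
  apply: (is_partition_perm_eq sP tP); rewrite -(perm_cons k).
  have tE := permEl (perm_sort geq (k :: t)).
  by apply: perm_trans tE; rewrite -E perm_sym perm_sort.
apply: uniq_perm.
- exact/filter_uniq/partitions_uniq.
- by rewrite map_inj_in_uniq ?partitions_uniq.
- move=> s; rewrite mem_filter mem_partitions.
  apply/andP/mapP => [[ks sP]|[t]].
    have /and3P[ss s0 /eqP sn] := sP.
    have psr := perm_to_rem ks.
    exists (rem k s).
      rewrite mem_partitions; apply/and3P; split.
      - apply: (subseq_sorted _ (rem_subseq k s) ss).
        by move=> x y z /= yx zy; apply: leq_trans zy yx.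
      - by apply/allP => j /mem_rem; apply/allP.
      - by rewrite -sn (perm_sumn psr) /= addKn.
    apply/esym/(@is_partition_perm_eq n n) => //.
      apply/and3P; split; first exact: sort_sorted.
      - by rewrite (perm_all _ (permEl (perm_sort _ _))) -(perm_all _ psr).
      - by rewrite (perm_sumn (permEl (perm_sort _ _))) -(perm_sumn psr) sn.
    by rewrite perm_sym (perm_trans psr) // perm_sym perm_sort.
  rewrite mem_partitions => /and3P[ts t0 /eqP tn] ->; split.
    by rewrite mem_sort mem_head.
  apply/and3P; split; first exact: sort_sorted.
  - by rewrite (perm_all _ (permEl (perm_sort _ _))) /= k0.
  - by rewrite (perm_sumn (permEl (perm_sort _ _))) /= tn subnKC.
Qed.

(** Parts are grouped by value. The bound m is kept free because it must not shrink with s in the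
    induction. *)
Lemma sum_count_mem f m s : all (leq 1) s -> (forall k, k \in s -> k <= m)%N ->
  (\sum_(1 <= k < m.+1) f k * count_mem k s = \sum_(k <- s) f k)%N.
Proof.
elim: s => [|j s IHs] /=.
  by move=> _ _; rewrite big_nil big1 // => k _; rewrite muln0.
move=> /andP[j0 s0] sm; rewrite big_cons -IHs // => [|k ks]; last first.
  by rewrite sm // inE ks orbT.
under eq_bigr do rewrite mulnDr.
rewrite big_split /=; congr addn.
have jm : j \in index_iota 1 m.+1 by rewrite mem_index_iota j0 ltnS sm ?mem_head.
rewrite (bigD1_seq j jm (iota_uniq _ _)) /= eqxx muln1 big1 ?addn0 //.
by move=> k kj; rewrite eq_sym (negPf kj) muln0.
Qed.

Lemma lenpartE s : all (leq 1) s -> lenpart s = size s.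
Proof.
move=> s0; rewrite -sum1_size -(sum_count_mem _ s0 (@mem_leq_sumn s)).
by apply: eq_bigr => k _; rewrite mul1n.
Qed.

(** Prepending j raises m_j by one, so only the factor at j changes, by j (m_j + 1); [zpart_rec]
    records exactly these factors. The bound [sumn s] is generalized to any m dominating the
    parts. *)
Lemma zpartE s : all (leq 1) s -> zpart s = zpart_rec s.
Proof.
rewrite /zpart; have : (forall k, k \in s -> k <= sumn s)%N by apply: mem_leq_sumn.
move: (sumn s) => m; elim: s => [|j s IHs] /=.
  by move=> _ _; rewrite big1 // => k _; rewrite /mult /= expn0 fact0.
move=> sm /andP[j0 s0]; rewrite -IHs //; last first.
  by move=> k ks; rewrite sm // inE ks orbT.
have jm : j \in index_iota 1 m.+1 by rewrite mem_index_iota j0 ltnS sm ?mem_head.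
rewrite !(bigD1_seq j jm (iota_uniq _ _)) /= {1 2}/mult /= eqxx add1n expnS factS.
rewrite [X in (_ * X = _)%N](eq_bigr (fun k => k ^ mult k s * (mult k s)`!)%N).
  by rewrite -/(mult j s); ring.
by move=> k kj; rewrite /mult /= eq_sym (negPf kj).
Qed.

Lemma zpart_perm s t : perm_eq s t -> zpart s = zpart t.
Proof.
move=> st; rewrite /zpart (perm_sumn st); apply: eq_bigr => k _.
by rewrite /mult (permP st).
Qed.

Lemma zpart_rec_gt0 s : all (leq 1) s -> (0 < zpart_rec s)%N.
Proof. by elim: s => //= k s IHs /andP[k0 /IHs]; rewrite !muln_gt0 k0. Qed.

Section CycleIndex.
Variables (F : numFieldType) (x : F).

Definition cycle_weight (s : seq nat) : F := x ^+ size s / (zpart s)%:R.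
Definition cycle_sum n := \sum_(s <- partitions n) cycle_weight s.

(** Inserting k multiplies z by k times the new multiplicity, which the prefactor cancels; the extra
    part leaves one factor x. *)
Lemma cycle_weight_sort k s : (0 < k)%N -> all (leq 1) s ->
  (k * count_mem k (sort geq (k :: s)))%:R * cycle_weight (sort geq (k :: s)) =
  x * cycle_weight s.
Proof.
move=> k0 s0; have st := permEl (perm_sort geq (k :: s)).
rewrite /cycle_weight size_sort (zpart_perm st) (permP st) /= eqxx add1n.
rewrite !zpartE /= ?k0 //; move: (count_mem k s) => c.
have z0 : (zpart_rec s)%:R != 0 :> F by rewrite pnatr_eq0 -lt0n zpart_rec_gt0.
have kc0 : (k * c.+1)%:R != 0 :> F by rewrite pnatr_eq0 -lt0n muln_gt0 k0.
rewrite (natrM _ (k * c.+1)) invfM exprS; move: (_ * _)%:R kc0 => d d0.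
by field; rewrite z0 d0.
Qed.

(** Write n as the sum of k m_k and exchange the sums: for fixed k, the partitions containing k are
    those of n - k with k inserted. *)
Lemma cycle_sum_recurrence n :
  n%:R * cycle_sum n = x * \sum_(i < n) cycle_sum i.
Proof.
have E s : s \in partitions n ->
    n%:R * cycle_weight s =
    \sum_(1 <= k < n.+1) (k * count_mem k s)%:R * cycle_weight s.
  rewrite mem_partitions => /and3P[_ s0 /eqP sn].
  rewrite -mulr_suml -natr_sum sum_count_mem -?sumnE ?sn // => k ks.
  by rewrite -sn mem_leq_sumn.
rewrite mulr_sumr (eq_big_seq _ E) exchange_big /=.
rewrite mulr_sumr -(big_mkord xpredT (fun i => x * cycle_sum i)).
(* The part size is reindexed as n - k, so that k numbers the sums on the right. *)
rewrite big_add1 /= big_nat_rev /= add0n big_nat_cond [RHS]big_nat_cond.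
apply: eq_bigr => k; rewrite andbT /= => kn.
rewrite subnSK; last by lia.
rewrite (bigID (fun s => (n - k)%N \in s)) /= [X in _ + X]big1 ?addr0.
  rewrite -big_filter (perm_big _ (perm_partitions_mem _)); last by lia.
  rewrite big_map mulr_sumr subKn; last by lia.
  apply: eq_big_seq => s; rewrite mem_partitions => /is_partition_all.
  by apply: cycle_weight_sort; lia.
by move=> s /count_memPn ->; rewrite muln0 mul0r.
Qed.

(** Comparing the recurrence at n + 1 and at n gives (n + 1) H_(n+1) = (x + n) H_n. *)
Lemma cycle_sumE n : cycle_sum n = (\prod_(i < n) (x + i%:R)) / n`!%:R.
Proof.
elim: n => [|n IHn].
  rewrite big_ord0 fact0 divr1 /cycle_sum (perm_big [:: [::]]) /=.
    by rewrite big_seq1 /cycle_weight /zpart big_geq // expr0 divr1.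
  apply: uniq_perm => // [|s]; first exact: partitions_uniq.
  rewrite mem_partitions inE; apply/and3P/eqP => [[_ s0 /eqP sn]|-> //].
  by apply/nilP; rewrite /nilp -leqn0 -sn size_leq_sumn.
have n1 : n.+1%:R != 0 :> F by rewrite pnatr_eq0.
have f0 : n`!%:R != 0 :> F by rewrite pnatr_eq0 -lt0n fact_gt0.
apply: (mulfI n1); rewrite cycle_sum_recurrence big_ord_recr mulrDr /=.
rewrite -cycle_sum_recurrence -mulrDl IHn big_ord_recr factS natrM /=.
move: (n.+1%:R) n1 => m m0; move: (n`!%:R) f0 => f f0.
by field; rewrite f0 m0.
Qed.

End CycleIndex.

Lemma gbinomE (F : fieldType) (x : F) n :
  gbinom (x + n%:R - 1) n = (\prod_(i < n) (x + i%:R)) / n`!%:R.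
Proof.
congr (_ / _); rewrite (reindex_inj rev_ord_inj); apply: eq_bigr => i _ /=.
by rewrite natrB //= -natr1; ring.
Qed.

Lemma gbinom_inv (F : fieldType) (q : F) n : q != 0 ->
  gbinom (q^-1 + n%:R - 1) n =
    (n`!%:R)^-1 * \prod_(1 <= j < n) (1 + j%:R * q) * q ^- n.
Proof.
move=> q0; rewrite gbinomE mulrC -mulrA; congr (_ * _).
have -> : \prod_(i < n) (q^-1 + i%:R) = \prod_(i < n) (1 + i%:R * q) * q^-1 ^+ n.
  have -> : q^-1 ^+ n = \prod_(i < n) q^-1 by rewrite prodr_const card_ord.
  rewrite -big_split /=.
  by apply: eq_bigr => i _; field.
rewrite exprVn -(big_mkord xpredT (fun j => 1 + j%:R * q)).
(* The factor at j = 0 equals 1; for n = 0 both products are empty. *)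
case: n => [|n]; first by rewrite !big_geq.
by rewrite big_ltn // mul0r addr0 mul1r.
Qed.

Lemma sum_partitionsE (F : fieldType) n (f : seq nat -> F) :
  \sum_(l : partition_of n) f (parts l) = \sum_(s <- partitions n) f s.
Proof. by rewrite big_image. Qed.

(** * The Shapovalov form on monomials *)

Section FockMonomials.
Variables (F : fieldType) (M : lmodType F) (q : F) (vac : M).
Variable b : int -> M -> M.

Definition fock_mon (s : seq nat) : M := foldr (fun k => b (- k%:Z)) vac s.

Hypothesis bZ : forall k a v, b k (a *: v) = a *: b k v.
(** Demanded only on monomials, where c is known to act as a scalar. *)
Hypothesis b_comm : forall k l s, b k (b l (fock_mon s)) =
  b l (b k (fock_mon s)) + (k%:~R * (k + l == 0)%:R * q) *: fock_mon s.
Hypothesis b_vac : forall k : nat, (0 < k)%N -> b k%:Z vac = 0.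

(** Creation operators commute, the sum of two negative indices never being zero, so one copy of k
    can be moved to the front. *)
Lemma fock_mon_rem k s : all (leq 1) s -> k \in s ->
  fock_mon (k :: rem k s) = fock_mon s.
Proof.
elim: s => //= j s IHs /andP[j0 s0]; rewrite inE eq_sym.
case: eqP => [-> //|/eqP jk] /= ks.
rewrite -(IHs s0 ks) b_comm (_ : _ + _ == 0 = false).
  by rewrite mulr0 mul0r scale0r addr0.
by apply/negP; lia.
Qed.

(** Moving b_k to the right until it kills the vacuum, a commutator k q appears once for each part
    equal to k. *)
Lemma fock_annihilate (k : nat) s : (0 < k)%N -> all (leq 1) s ->
  b k%:Z (fock_mon s) = ((k * count_mem k s)%:R * q) *: fock_mon (rem k s).
Proof.
move=> k0; elim: s => /= [_|j s IHs /andP[j0 s0]].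
  by rewrite b_vac // muln0 mul0r scale0r.
rewrite b_comm IHs // bZ.
rewrite (_ : (k%:Z - j%:Z == 0) = (j == k)); last by apply/eqP/eqP; lia.
case: (j =P k) => [->|_] /=; last by rewrite mulr0 mul0r scale0r addr0 add0n.
have [ks|ks] := boolP (k \in s).
  rewrite -[b (- k%:Z) _]/(fock_mon (k :: rem k s)) fock_mon_rem // -scalerDl.
  by congr (_ *: _); rewrite mulnDr natrD muln1 mulr1; ring.
by rewrite (count_memPn ks) muln0 mul0r scale0r add0r addn0 muln1 mulr1.
Qed.

Variable S : M -> M -> F.
Hypothesis S_sym : forall v w, S v w = S w v.
Hypothesis S_linear : forall a u v w, S (a *: u + v) w = a * S u w + S v w.
Hypothesis S_vac : S vac vac = 1.
Hypothesis S_adj : forall k v w, S (b (- k%:Z) v) w = S v (b k%:Z w).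

Lemma fock_form0l w : S 0 w = 0.
Proof.
by have := S_linear (-1) 0 0 w; rewrite scaler0 addr0 mulN1r addNr.
Qed.

Lemma fock_formZr a v w : S v (a *: w) = a * S v w.
Proof. by rewrite S_sym -[a *: w]addr0 S_linear fock_form0l addr0 S_sym. Qed.

(** The first factor crosses the form by adjunction and becomes b_k, which strips one part k off t;
    the factors k m_k(t) collected on the way build z. *)
Lemma fock_form_mon s t : all (leq 1) s -> all (leq 1) t ->
  S (fock_mon s) (fock_mon t) = (perm_eq s t)%:R * (zpart_rec s)%:R * q ^+ size s.
Proof.
elim: s t => [|k s IHs] t /=.
  move=> _; case: t => [|k t] /=; first by rewrite S_vac !mulr1.
  move=> /andP[k0 t0]; rewrite S_sym S_adj b_vac // S_sym fock_form0l.
  rewrite (_ : perm_eq _ _ = false) ?mul0r //.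
  by apply/negP => /perm_size.
move=> /andP[k0 s0] t0; rewrite S_adj fock_annihilate // fock_formZr.
have [kt|kt] := boolP (k \in t); last first.
  rewrite (count_memPn kt) muln0 !mul0r.
  suff -> : perm_eq (k :: s) t = false by rewrite !mul0r.
  by apply/negP => /perm_mem/(_ k); rewrite (negPf kt) mem_head.
rewrite IHs //; last by apply/allP => j /mem_rem; apply/allP.
have -> : perm_eq (k :: s) t = perm_eq s (rem k t).
  by rewrite (permPr (perm_to_rem kt)) perm_cons.
case: (boolP (perm_eq s (rem k t))) => [st|_]; last by rewrite !mul0r mulr0.
have -> : count_mem k t = (count_mem k s).+1.
  by rewrite (permP (perm_to_rem kt)) /= eqxx (permP st).
by rewrite !natrM exprS; ring.
Qed.

End FockMonomials.

(** * Heisenberg relations in the enveloping algebra *)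

Section HeisenbergRelations.
Variables (R : realType) (w1 : R).
Local Notation C := R[i].

(** [heis_tensor_of] is a sum over the support, so linearity is not immediate, and a = 0, with empty
    support, is a separate case. Multiples of basis vectors suffice, as every bracket of basis
    vectors is one. *)
Lemma heis_tensor_ofU g (a : C) :
  heis_tensor_of (a *: heis_basis R g) = a *: heis_tensor_of (heis_basis R g).
Proof.
have E b : b *: heis_basis R g = mkmalgU g b.
  by apply/malgP => h; rewrite mcoeffZ !mcoeffU mulrnAr mulr1.
rewrite E /heis_tensor_of !msuppU oner_eq0 big_seq_fset1 mcoeffUU scale1r.
case: eqP => [->|_]; first by rewrite big_seq_fset0 scale0r.
by rewrite big_seq_fset1 mcoeffUU.
Qed.

Lemma heis_bracket_basis g h :
  heis_bracket w1 (heis_basis R g) (heis_basis R h) = heis_gen_bracket w1 g h.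
Proof.
rewrite /heis_bracket !msuppU oner_eq0 !big_seq_fset1 !mcoeffUU.
by rewrite mulr1 scale1r.
Qed.

Lemma uea_ofU g (a : C) :
  uea_of w1 (a *: heis_basis R g) = a *: uea_of w1 (heis_basis R g).
Proof. by rewrite /uea_of heis_tensor_ofU linearZ. Qed.

Lemma uea_b_comm k l : uea_b w1 k * uea_b w1 l =
  uea_b w1 l * uea_b w1 k + (k%:~R * (k + l == 0)%:R * w1%:C) *: uea_c w1.
Proof.
apply/eqP; rewrite addrC -subr_eq; apply/eqP.
by rewrite uea_of_bracket heis_bracket_basis /= uea_ofU.
Qed.

Lemma uea_c_comm k : uea_c w1 * uea_b w1 k = uea_b w1 k * uea_c w1.
Proof.
apply/eqP; rewrite -subr_eq0; apply/eqP.
rewrite uea_of_bracket heis_bracket_basis /=.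
by rewrite -(scale0r (heis_c R)) uea_ofU scale0r.
Qed.

End HeisenbergRelations.

(** * Monomials in the Verma module *)

Section VermaMonomials.
Variables (R : realType) (w1 : R) (phi : {scalar heis0 R}).
Local Notation C := R[i].
Local Notation M := (verma w1 phi).
Local Notation q := (level w1 phi).

Lemma verma_actZ x a (v : M) : verma_act x (a *: v) = a *: verma_act x v.
Proof.
have act0 : verma_act x (0 : M) = 0.
  by have := verma_act_linear x (-1) (0 : M) 0; rewrite scaler0 addr0 scaleN1r addNr.
by rewrite -[a *: v]addr0 verma_act_linear act0 addr0.
Qed.

Lemma verma_act_comm x y z a c (v : M) :
  x * y = y * x + a *: z -> verma_act z v = c *: v ->
  verma_act x (verma_act y v) = verma_act y (verma_act x v) + (a * c) *: v.
Proof.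
move=> xy zv; rewrite -verma_actM xy verma_actDl verma_actM verma_actZl zv.
by rewrite scalerA.
Qed.

Definition verma_op (k : int) : M -> M := verma_act (uea_b w1 k).
Local Notation mon := (fock_mon (verma_vec w1 phi) verma_op).

Lemma verma_act_prod s :
  verma_act (\prod_(k <- s) uea_b w1 (- k%:Z)) (verma_vec w1 phi) = mon s.
Proof.
elim: s => [|k s IHs]; first by rewrite big_nil verma_act1.
by rewrite big_cons verma_actM IHs.
Qed.

(** c is central, so its scalar on the highest weight vector passes through all creation
    operators. *)
Lemma verma_act_c_mon s :
  verma_act (uea_c w1) (mon s) = phi (heis0_c R) *: mon s.
Proof.
elim: s => [|k s IHs].
  exact: (verma_vec_acts (borel_acts_zero w1 phi (heis0_c R))).
have comm : uea_c w1 * uea_b w1 (- k%:Z) =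
    uea_b w1 (- k%:Z) * uea_c w1 + 0 *: uea_c w1.
  by rewrite uea_c_comm scale0r addr0.
apply: etrans (verma_act_comm comm IHs) _.
by rewrite mul0r scale0r addr0 IHs verma_actZ.
Qed.

Lemma verma_op_comm k l s : verma_op k (verma_op l (mon s)) =
  verma_op l (verma_op k (mon s)) + (k%:~R * (k + l == 0)%:R * q) *: mon s.
Proof.
apply: etrans (verma_act_comm (uea_b_comm w1 k l) (verma_act_c_mon s)) _.
by rewrite /level mulrA.
Qed.

Lemma verma_op_vec (k : nat) : (0 < k)%N -> verma_op k%:Z (verma_vec w1 phi) = 0.
Proof.
move=> k0; rewrite -[RHS](scale0r (verma_vec w1 phi)).
by apply: verma_vec_acts; apply: borel_acts_pos.
Qed.

Lemma shapovalov_mon (omega : uea w1 -> uea w1) (S : M -> M -> C) :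
  heis_antiautomorphism omega -> shapovalov_form omega S ->
  forall s t, all (leq 1) s -> all (leq 1) t ->
  S (mon s) (mon t) = (perm_eq s t)%:R * (zpart_rec s)%:R * q ^+ size s.
Proof.
move=> omegaP SP s t s0 t0.
apply: (fock_form_mon (b := verma_op)) => //.
- by move=> k a v; apply: verma_actZ.
- exact: verma_op_comm.
- exact: verma_op_vec.
- exact: (shapovalov_sym SP).
- exact: (shapovalov_linear SP).
- exact: (shapovalov_vec SP).
- move=> k v w; rewrite /verma_op (shapovalov_contra SP) (antiaut_b omegaP).
  by rewrite opprK.
Qed.

End VermaMonomials.

Lemma gbinom_gt0 (F : numFieldType) (x : F) n : 0 < x -> 0 < gbinom (x + n%:R - 1) n.
Proof.
move=> x0; rewrite gbinomE divr_gt0 ?ltr0n ?fact_gt0 // prodr_gt0 // => i _.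
by rewrite ltr_wpDr.
Qed.

(** * Representing vectors and their pairings *)

Section ShapovalovForm.
Variables (R : realType) (w1 : R) (phi : {scalar heis0 R}).
Variables (omega : uea w1 -> uea w1) (S : verma w1 phi -> verma w1 phi -> R[i]).
Hypothesis omegaP : heis_antiautomorphism omega.
Hypothesis SP : shapovalov_form omega S.
Local Notation C := R[i].
Local Notation M := (verma w1 phi).
Local Notation q := (level w1 phi).

Definition norm_part n (l : partition_of n) : C :=
  (zpart (parts l))%:R * q ^+ lenpart (parts l).

Lemma shapovalov_verma_b n (l l' : partition_of n) :
  S (verma_b w1 phi l) (verma_b w1 phi l') = (l == l')%:R * norm_part l.
Proof.
have l0 := is_partition_all (partsP l); have l0' := is_partition_all (partsP l').
rewrite /verma_b !verma_act_prod (shapovalov_mon omegaP SP) // /norm_part.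
rewrite zpartE // lenpartE // mulrA; congr ((nat_of_bool _)%:R * _ * _).
apply/idP/eqP => [|-> //] h; apply/parts_inj.
exact: is_partition_perm_eq (partsP l) (partsP l') h.
Qed.

Lemma shapovalov_suml n (a : partition_of n -> C) w :
  S (\sum_l a l *: verma_b w1 phi l) w = \sum_l a l * S (verma_b w1 phi l) w.
Proof.
apply: (big_ind2 (fun v c => S v w = c)) => [|u c v d <- <-|l _].
- exact: fock_form0l (shapovalov_linear SP) w.
- by rewrite -[u in LHS]scale1r (shapovalov_linear SP) mul1r.
- rewrite (shapovalov_sym SP).
  rewrite (fock_formZr (shapovalov_sym SP) (shapovalov_linear SP)).
  by rewrite (shapovalov_sym SP).
Qed.

Lemma shapovalov_sumr n (a : partition_of n -> C) v :
  S v (\sum_l a l *: verma_b w1 phi l) = \sum_l a l * S v (verma_b w1 phi l).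
Proof.
rewrite (shapovalov_sym SP) shapovalov_suml; apply: eq_bigr => l _.
by rewrite (shapovalov_sym SP).
Qed.

Lemma shapovalov_comb_verma_b n (a : partition_of n -> C) l :
  S (\sum_l a l *: verma_b w1 phi l) (verma_b w1 phi l) = a l * norm_part l.
Proof.
rewrite shapovalov_suml (bigD1 l) //= shapovalov_verma_b eqxx mul1r big1 ?addr0 //.
by move=> l' /negPf l'l; rewrite shapovalov_verma_b l'l mul0r mulr0.
Qed.

Lemma in_degree_verma_b n (l : partition_of n) : in_degree n (verma_b w1 phi l).
Proof.
exists (fun l' => (l' == l)%:R).
rewrite (bigD1 l) //= eqxx scale1r big1 ?addr0 // => l' /negPf ->.
by rewrite scale0r.
Qed.

Lemma partition_functional_sum n (mu : M -> C) (a : partition_of n -> C) :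
  partition_functional n mu -> mu (\sum_l a l *: verma_b w1 phi l) = \sum_l a l.
Proof.
move=> muP.
have deg0 : in_degree n (0 : M).
  by exists (fun=> 0); rewrite big1 // => l _; rewrite scale0r.
have mu0 : mu 0 = 0.
  by have := mu_linear muP (-1) deg0 deg0; rewrite scaler0 addr0 mulN1r addNr.
(* [mu] is linear only on degree n, so membership is carried along with the value. *)
pose K (v : M) (c : C) := in_degree n v /\ mu v = c.
suff [] : K (\sum_l a l *: verma_b w1 phi l) (\sum_l a l) by [].
apply: (big_ind2 K); first by split.
  move=> u c v d [Du <-] [Dv <-]; split; last first.
    by rewrite -[u in LHS]scale1r (mu_linear muP) ?mul1r.
  have [a1 ->] := Du; have [a2 ->] := Dv; exists (fun l => a1 l + a2 l).
  by rewrite -big_split; apply: eq_bigr => l _; rewrite scalerDl.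
move=> l _; have Dl := in_degree_verma_b l.
split; last by rewrite -[_ *: _]addr0 (mu_linear muP) // mu0 addr0 (mu_b muP) mulr1.
have [a1 Ea] := Dl; exists (fun l' => a l * a1 l'); rewrite {1}Ea scaler_sumr.
by apply: eq_bigr => l' _; rewrite scalerA.
Qed.

(** A partition of 1 has at least one part, so q = 0 would make the Gram matrix in degree 1
    vanish. *)
Lemma shapovalov_regular_level_neq0 : shapovalov_regular S -> q != 0.
Proof.
move=> /(_ 1 isT); apply: contra => /eqP q0.
have [l _] := @parts_surj 1 [:: 1] isT.
suff -> : shapovalov_gram S 1 = 0.
  (* An empty matrix has determinant 1, so the index set must be inhabited. *)
  have : (0 < #|{: partition_of 1}|)%N by apply/fintype.card_gt0P; exists l.
  by case: #|_| => // m _; rewrite det0.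
apply/matrixP => i j; rewrite !mxE shapovalov_verma_b /norm_part q0.
set p := enum_val i; have pP := partsP p.
rewrite lenpartE ?(is_partition_all pP) //; case/and3P: pP => _ _.
by case: (parts p) => //= k s _; rewrite expr0n mulr0 mulr0.
Qed.

Hypothesis q0 : q != 0.

Lemma norm_part_neq0 n (l : partition_of n) : norm_part l != 0.
Proof.
have l0 := is_partition_all (partsP l).
by rewrite mulf_neq0 ?expf_neq0 // zpartE // pnatr_eq0 -lt0n zpart_rec_gt0.
Qed.

Lemma ptildeE n (k : C) :
  ptilde w1 phi n k =
    \sum_(l : partition_of n) (k / norm_part l) *: verma_b w1 phi l.
Proof.
by rewrite /ptilde scaler_sumr; apply: eq_bigr => l _; rewrite scalerA.
Qed.

(** Pairing with one monomial isolates its coefficient and forces it to be k divided by the squared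
    norm. Conversely, these coefficients turn the pairing with w into k times the sum of the
    coefficients of w, which is [mu w]. *)
Lemma represents_ptilde n (mu : M -> C) (k : C) (P : M) :
  partition_functional n mu ->
  represents S mu n k P <-> P = ptilde w1 phi n k.
Proof.
move=> muP; split=> [[[a ->] aS]|->].
  rewrite ptildeE; apply: eq_bigr => l _; congr (_ *: _).
  have := aS _ (in_degree_verma_b l).
  rewrite shapovalov_comb_verma_b (mu_b muP) mulr1 => <-.
  by rewrite mulfK ?norm_part_neq0.
rewrite ptildeE; split; first by exists (fun l => k / norm_part l).
move=> w [a ->]; rewrite (partition_functional_sum _ muP) shapovalov_sumr mulr_sumr.
apply: eq_bigr => l _; rewrite shapovalov_comb_verma_b.
by rewrite divfK ?norm_part_neq0 // mulrC.
Qed.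

Lemma sum_norm_part n :
  \sum_(l : partition_of n) (norm_part l)^-1 = gbinom (q^-1 + n%:R - 1) n.
Proof.
rewrite gbinomE -cycle_sumE /cycle_sum -sum_partitionsE; apply: eq_bigr => l _.
rewrite /norm_part /cycle_weight lenpartE ?(is_partition_all (partsP l)) //.
by rewrite invfM exprVn mulrC.
Qed.

Lemma shapovalov_ptilde n k k' :
  S (ptilde w1 phi n k) (ptilde w1 phi n k') =
    k * k' * gbinom (q^-1 + n%:R - 1) n.
Proof.
rewrite -sum_norm_part mulr_sumr !ptildeE shapovalov_sumr; apply: eq_bigr => l _.
rewrite shapovalov_comb_verma_b divfK ?norm_part_neq0 //; ring.
Qed.

Lemma shapovalov_ptilde_neq n n' k k' : n <> n' ->
  S (ptilde w1 phi n k) (ptilde w1 phi n' k') = 0.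
Proof.
by move=> nn'; rewrite !ptildeE; apply: (shapovalov_degree SP nn'); eexists.
Qed.

End ShapovalovForm.

(** * Legendre polynomials *)

Section PolyPrimitive.
Variable F : numFieldType.
Implicit Types p q : {poly F}.

(* The constant coefficient is [_ / 0 = 0]. *)
Definition prim p : {poly F} := \poly_(i < (size p).+1) (p`_i.-1 / i%:R).

Lemma coef_prim p i : (prim p)`_i = p`_i.-1 / i%:R.
Proof.
rewrite coef_poly; case: ltnP => // ip; case: i ip => // i ip.
by rewrite nth_default ?mul0r.
Qed.

Lemma deriv_prim p : (prim p)^`() = p.
Proof.
apply/polyP => i; rewrite coef_deriv coef_prim -(mulr_natr (_ / _)).
by rewrite divfK ?pnatr_eq0.
Qed.

(** The integral over [-1, 1], kept formal so that the Legendre identities stay algebraic. *)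
Definition symint p : F := (prim p).[1] - (prim p).[-1].

Fact symint_is_linear : linear_for *%R symint.
Proof.
move=> a p q; rewrite /symint; have -> : prim (a *: p + q) = a *: prim p + prim q.
  apply/polyP => i; rewrite coefD coefZ !coef_prim coefD coefZ.
  by rewrite mulrDl mulrA.
by rewrite !hornerE /=; ring.
Qed.
HB.instance Definition _ :=
  GRing.isLinear.Build F {poly F} F *%R symint symint_is_linear.

Lemma symint_deriv p : symint p^`() = p.[1] - p.[-1].
Proof.
have E : prim p^`() = p - (p`_0)%:P.
  apply/polyP => -[|i]; rewrite coef_prim coefB coefC /= ?subrr ?invr0 ?mulr0 //.
  by rewrite coef_deriv subr0 -(mulr_natr _`_i.+1) mulfK ?pnatr_eq0.
by rewrite /symint E !hornerE; ring.
Qed.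

Lemma symint_natM n p : symint (n%:R * p) = n%:R * symint p.
Proof. by rewrite mulr_natl raddfMn /= mulr_natl. Qed.

End PolyPrimitive.

(** * Consequences of the three-term recurrence *)

Section LegendreRecurrence.
Variables (F : numFieldType) (L : nat -> {poly F}).
Hypothesis L0 : L 0 = 1.
Hypothesis L1 : L 1 = 'X.
Hypothesis Lrec : forall n,
  n.+2%:R * L n.+2 = (2 * n + 3)%:R * 'X * L n.+1 - n.+1%:R * L n.

(** Both identities go through the induction together: the differentiated recurrence, with the
    derivative of [L n] eliminated by the first, gives the second one step up; the first then
    follows from it and the recurrence. *)
Lemma legendre_deriv_rec n :
  'X * (L n.+1)^`() - (L n)^`() = n.+1%:R * L n.+1 /\
  (L n.+1)^`() - 'X * (L n)^`() = n.+1%:R * L n.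
Proof.
elim: n => [|n [IHa IHb]].
  by rewrite L0 L1 derivX -[1]/(1%:P : {poly F}) derivC; split; ring.
have Lrec' : n.+2%:R * (L n.+2)^`() =
    (2 * n + 3)%:R * (L n.+1 + 'X * (L n.+1)^`()) - n.+1%:R * (L n)^`().
  have := congr1 (@deriv F) (Lrec n).
  rewrite -!polyC_natr !mul_polyC -?scalerAl derivB !derivZ derivM derivX.
  by rewrite -!mul_polyC => ->; ring.
have n2 : (n.+2%:R : {poly F}) != 0 by rewrite -polyC_natr polyC_eq0 pnatr_eq0.
have B : (L n.+2)^`() - 'X * (L n.+1)^`() = n.+2%:R * L n.+1.
  apply: (mulfI n2); rewrite mulrBr Lrec'.
  have -> : (L n)^`() = 'X * (L n.+1)^`() - n.+1%:R * L n.+1.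
    by rewrite -IHa; ring.
  by ring.
split=> //.
have -> : (L n.+2)^`() = 'X * (L n.+1)^`() + n.+2%:R * L n.+1.
  by rewrite -B; ring.
rewrite Lrec.
have E : n.+1%:R * L n = (L n.+1)^`() - 'X * ('X * (L n.+1)^`() - n.+1%:R * L n.+1).
  by rewrite -IHb -IHa; ring.
by rewrite E; ring.
Qed.

(** For n >= 1 the derivative relations combine to (1 - X^2) L_n' = n (L_(n-1) - X L_n);
    differentiate this and apply the first relation again. *)
Lemma legendre_ode n :
  ((1 - 'X^2) * (L n)^`())^`() = - ((n * n.+1)%:R * L n).
Proof.
case: n => [|n].
  by rewrite L0 -[1]/(1%:P : {poly F}) derivC mulr0 deriv0 !mul0r oppr0.
have [A B] := legendre_deriv_rec n.
have -> : (1 - 'X^2) * (L n.+1)^`() = n.+1%:R *: (L n - 'X * L n.+1).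
  rewrite -mul_polyC polyC_natr mulrBr -B.
  have -> : n.+1%:R * ('X * L n.+1) = 'X * ('X * (L n.+1)^`() - (L n)^`()).
    by rewrite A; ring.
  by ring.
rewrite derivZ derivB derivM derivX -mul_polyC polyC_natr.
have -> : (L n)^`() = 'X * (L n.+1)^`() - n.+1%:R * L n.+1 by rewrite -A; ring.
by rewrite natrM; ring.
Qed.

(* Sturm-Liouville: the two eigenvalues differ and the boundary terms carry *)
(* the factor [1 - 'X^2].                                                    *)
Lemma legendre_orthogonal n m : n != m -> symint (L n * L m) = 0.
Proof.
move=> nm; pose e k : F := (k * k.+1)%:R.
have e_neq : e m - e n != 0.
  rewrite subr_eq0 eqr_nat; apply: contra nm => /eqP h; apply/eqP.
  by case: (ltngtP n m) => // lt_nm; have := ltn_mul lt_nm lt_nm; nia.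
apply: (mulfI e_neq); rewrite mulr0.
pose W := (1 - 'X^2) * (L n)^`() * L m - (1 - 'X^2) * (L m)^`() * L n.
have -> : (e m - e n) * symint (L n * L m) = symint W^`().
  rewrite -linearZ /=; congr symint; rewrite /W derivB.
  rewrite (derivM (_ * _)) (derivM ((1 - 'X^2) * _)) !legendre_ode.
  by rewrite -mul_polyC /e polyCB !polyC_natr; ring.
by rewrite symint_deriv /W !hornerE; ring.
Qed.

(** The integral of X L_n L_(n+1) is tied to both norms: the recurrence rewrites one factor of
    L_(n+1)^2, or X L_(n+1) in the product, and orthogonality removes the cross term. Consecutive
    norms thus have ratio (2n+1)/(2n+3). *)
Lemma legendre_norm n : symint (L n ^+ 2) = 2 / (2 * n%:R + 1).
Proof.
elim: n => [|n IHn].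
  rewrite L0 expr1n mulr0 add0r divr1.
  have -> : 1 = ('X : {poly F})^`() :> {poly F} by rewrite derivX.
  by rewrite symint_deriv !hornerE; ring.
have E1 : n.+1%:R * symint (L n.+1 ^+ 2) =
    (2 * n + 1)%:R * symint ('X * L n * L n.+1).
  (* [Lrec] starts at [L 2], so [L 1] is treated by hand. *)
  rewrite -!symint_natM; case: n {IHn} => [|n].
    by rewrite L0 L1; congr symint; ring.
  have -> : n.+2%:R * L n.+2 ^+ 2 = (2 * n + 3)%:R * ('X * L n.+1 * L n.+2)
                                    - n.+1%:R * (L n * L n.+2).
    by rewrite expr2 mulrA Lrec; ring.
  rewrite raddfB /= (symint_natM n.+1) legendre_orthogonal; last by lia.
  by rewrite mulr0 subr0; congr (symint (_%:R * _)); lia.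
have E2 : (2 * n + 3)%:R * symint ('X * L n * L n.+1) =
    n.+1%:R * symint (L n ^+ 2).
  rewrite -!symint_natM.
  have -> : (2 * n + 3)%:R * ('X * L n * L n.+1) =
      n.+2%:R * (L n.+2 * L n) + n.+1%:R * (L n ^+ 2).
    by rewrite [n.+2%:R * _]mulrA Lrec; ring.
  rewrite raddfD /= symint_natM legendre_orthogonal; last by lia.
  by rewrite mulr0 add0r.
have n1 : n.+1%:R != 0 :> F by rewrite pnatr_eq0.
have d1 : (2 * n + 1)%:R != 0 :> F by rewrite pnatr_eq0; lia.
have d3 : (2 * n + 3)%:R != 0 :> F by rewrite pnatr_eq0; lia.
have d1' : 2 * n%:R + 1 = (2 * n + 1)%:R :> F by ring.
have d3' : 2 * n.+1%:R + 1 = (2 * n + 3)%:R :> F by ring.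
apply: (mulfI n1); rewrite E1.
apply: (mulfI d3); rewrite mulrCA E2 IHn d1' d3'.
by rewrite !(mulrCA _ n.+1%:R) !(mulrC _ (2 / _)) !divfK.
Qed.

End LegendreRecurrence.

(** * Power series near 0 and uniqueness of coefficients *)

Section PowerSeries.
Variable R : realType.
Implicit Types (c d : R^nat) (f g : R -> R).

Definition sums_near0 c f :=
  \forall t \near (0 : R), pseries c t @ \oo --> f t.

(* The factor [4] leaves room for [n + 1 <= 2 ^ n] and a geometric series. *)
Lemma cvg_pseries_diffs c (K : R) : 0 < K ->
  cvgn (pseries c K) -> cvgn (pseries (pseries_diffs c) (K / 4)).
Proof.
move=> K0 /cvg_series_bounded [M0 [_ /(_ (`|M0| + 1))]].
move=> /(_ (le_lt_trans (ler_norm _) (ltr_pwDr ltr01 (lexx _)))).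
set M := `|M0| + 1 => cM; have M_ge0 : 0 <= M by rewrite addr_ge0.
apply: normed_cvg.
apply: (@series_le_cvg _ _ (geometric (M / K) 2^-1)) => [n|n|n|] //=.
- by rewrite mulr_ge0 ?exprn_ge0 ?divr_ge0 // ltW.
- have {}cM := cM n.+1 I; rewrite /= normrM normrX (gtr0_norm K0) in cM.
  have K4_gt0 : 0 < K / 4 by lra.
  rewrite /pseries_diffs !normrM normrX normr_nat (gtr0_norm K4_gt0).
  have K4 : (K / 4) ^+ n = K ^+ n.+1 * (2 ^- n * 2 ^- n) * K^-1.
    have -> : K / 4 = K * (2^-1 * 2^-1) by field.
    by rewrite !exprMn exprVn exprS; field; rewrite gt_eqF ?exprn_gt0 //= gt_eqF.
  have -> : n.+1%:R * `|c n.+1| * (K / 4) ^+ n =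
      (`|c n.+1| * K ^+ n.+1 / K * 2^-1 ^+ n) * (n.+1%:R * 2 ^- n).
    by rewrite K4 exprVn; ring.
  have n2 : n.+1%:R * 2 ^- n <= 1 :> R.
    by rewrite ler_pdivrMr ?mul1r ?exprn_gt0 // -natrX ler_nat ltn_expl.
  apply: le_trans (_ : `|c n.+1| * K ^+ n.+1 / K * 2^-1 ^+ n <= _).
    rewrite ler_piMr // !mulr_ge0 ?exprn_ge0 ?invr_ge0 //; exact: ltW.
  rewrite ler_wpM2r ?exprn_ge0 ?invr_ge0 // ler_wpM2r ?invr_ge0 //.
  exact: ltW.
- by apply: is_cvg_geometric_series; rewrite gtr0_norm //; lra.
Qed.

Lemma sums_near0P c f : sums_near0 c f <->
  exists2 e : R, 0 < e & forall t, `|t| < e -> pseries c t @ \oo --> f t.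
Proof.
split=> [/nbhs_ballP[e /= e0 h]|[e e0 h]].
  by exists e => // t te; apply: h; rewrite -ball_normE /= sub0r normrN.
apply/nbhs_ballP; exists e => //= t; rewrite -ball_normE /= sub0r normrN.
exact: h.
Qed.

(** [pseries_snd_diffs] needs the series and its first two differentiated series to converge at a
    point beyond t, so the radius shrinks twice. Uniqueness of the derivative identifies the sum
    with g. *)
Lemma sums_near0_derive c f g : sums_near0 c f ->
  (\forall t \near (0 : R), is_derive (t : R) (1 : R) f (g t)) ->
  sums_near0 (pseries_diffs c) g.
Proof.
move=> /sums_near0P [e e0 cf] fg.
(* K lies strictly inside the disc of convergence; each differentiation costs a factor 4. *)
pose K := e / 2; have K0 : 0 < K by rewrite divr_gt0.
have cK : cvgn (pseries c K).
  by apply/cvg_ex; exists (f K); apply: cf; rewrite gtr0_norm // /K; lra.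
have dK := cvg_pseries_diffs K0 cK.
have K4 : 0 < K / 4 by lra.
have ddK := cvg_pseries_diffs K4 dK.
have K16 : 0 < K / 4 / 4 by lra.
near=> t.
have tK : `|t| < K / 4 / 4.
  near: t; exact: (@nbhs0_lt R R).
have inside h (x y : R) : 0 < x -> x <= y -> cvgn (pseries h y) ->
    x < y -> cvgn (pseries h x).
  move=> x0 xy hy lt_xy; apply: is_cvg_pseries_inside hy _.
  by rewrite !gtr0_norm // (lt_trans x0).
have ck' : cvgn (pseries c (K / 4 / 4)) by apply: inside cK _ => //; lra.
have dk' : cvgn (pseries (pseries_diffs c) (K / 4 / 4)).
  by apply: inside dK _ => //; lra.
have D : is_derive (t : R) (1 : R) (fun x => limn (pseries c x))
    (limn (pseries (pseries_diffs c) t)).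
  by apply: pseries_snd_diffs ck' dk' ddK _; rewrite (gtr0_norm K16).
have D' : is_derive (t : R) (1 : R) f (limn (pseries (pseries_diffs c) t)).
  apply: near_eq_is_derive D; near=> x.
  apply: cvg_lim => //; apply: cf.
  have : `|x| < K / 4 / 4; last by rewrite /K; lra.
  near: x; have : \forall x \near t, `|x| < K / 4 / 4.
    exact: (@cvgr_norm_lt _ R R (nbhs t) _ id t cvg_id _ tK).
  by [].
have G : is_derive (t : R) (1 : R) f (g t) by near: t.
have -> : g t = limn (pseries (pseries_diffs c) t).
  by rewrite -(@derive_val _ _ _ _ _ _ _ G) -(@derive_val _ _ _ _ _ _ _ D').
apply: is_cvg_pseries_inside dk' _; rewrite (gtr0_norm K16) //.
Unshelve. all: by end_near. Qed.

Lemma sums_near0_eq c f g : (\forall t \near (0 : R), f t = g t) ->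
  sums_near0 c f -> sums_near0 c g.
Proof.
move=> fg cf; near=> t; have <- : f t = g t by near: t.
by near: t.
Unshelve. all: by end_near. Qed.

Lemma sums_near0_at0 c f : sums_near0 c f -> c 0 = f 0.
Proof.
move=> /sums_near0P [e e0 /(_ 0)]; rewrite normr0 => /(_ e0) h.
rewrite -(cvg_lim (@Rhausdorff R) h); apply/esym/(cvg_lim (@Rhausdorff R)).
apply: cvg_near_cst; near=> n.
have n0 : (0 < n)%N by near: n; exists 1%N.
rewrite /pseries /series /= big_ltn // expr0 mulr1 big_nat_cond big1 ?addr0 //.
by move=> i; rewrite andbT => /andP[i0 _]; rewrite expr0n gtn_eqF // mulr0.
Unshelve. all: by end_near. Qed.

(** Differentiating the zero function reduces the coefficient n + 1 of c to the coefficient n of its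
    derived series, up to the nonzero factor n + 1. *)
Lemma sums_near0_unique c : sums_near0 c (cst 0) -> forall n, c n = 0.
Proof.
move=> c0 n; elim: n c c0 => [|n IHn] c c0; first exact: (sums_near0_at0 c0).
have := IHn (pseries_diffs c) (sums_near0_derive c0 _).
rewrite /pseries_diffs => h; apply/eqP.
have /h/eqP : \forall t \near (0 : R), is_derive (t : R) (1 : R) (@cst R R 0) 0.
  by near=> t; exact: is_derive_cst.
by rewrite mulf_eq0 pnatr_eq0.
Unshelve. all: by end_near. Qed.

Lemma sums_near0_comb a c d f g : sums_near0 c f -> sums_near0 d g ->
  sums_near0 (fun n => a * c n + d n) (fun t => a * f t + g t).
Proof.
move=> cf dg; near=> t.
have -> : pseries (fun n => a * c n + d n) t =
    (fun n => a * pseries c t n + pseries d t n).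
  apply/funext => n; rewrite /pseries /series /= mulr_sumr -big_split /=.
  by apply: eq_bigr => i _; rewrite mulrDl mulrA.
by apply: cvgD; [apply: cvgMr; near: t|near: t].
Unshelve. all: by end_near. Qed.

Definition shift_seq c n := if n is m.+1 then c m else 0.

Lemma sums_near0_shift c f : sums_near0 c f ->
  sums_near0 (shift_seq c) (fun t => t * f t).
Proof.
move=> cf; near=> t.
have E : (fun n => pseries (shift_seq c) t n.+1) = (fun n => t * pseries c t n).
  apply/funext => n; rewrite /pseries /series /= big_nat_recl // mul0r add0r.
  by rewrite mulr_sumr; apply: eq_bigr => i _; rewrite exprS /= mulrCA.
rewrite -cvg_shiftS; rewrite E.
by apply: cvgMr; near: t.
Unshelve. all: by end_near. Qed.

End PowerSeries.

(** * From the generating function to the recurrence *)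

Section LegendreSeries.
Variables (R : realType) (a : R).

Lemma legendre_series_recurrence (c : R^nat) :
  sums_near0 c (fun t => (1 - 2 * a * t + t ^+ 2) `^ (- 2^-1)) ->
  [/\ c 0 = 1, c 1 = a & forall n,
    n.+2%:R * c n.+2 = (2 * n + 3)%:R * a * c n.+1 - n.+1%:R * c n].
Proof.
set f := fun t => _ => cf.
pose p t : R := 1 - 2 * a * t + t ^+ 2.
pose g t := - 2^-1 * p t `^ (- 2^-1 - 1) * (2 * t - 2 * a).
(* p(0) = 1, so p is positive near 0 and its real powers are differentiable there. *)
have p_gt0 : \forall t \near 0, 0 < p t.
  have : p @ 0 --> p 0.
    by apply: cvgD; [apply: cvgB; [exact: cvg_cst|apply: cvgMr; exact: cvg_id]
      |apply: exprn_continuous].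
  by move=> /cvgr_gt; apply; rewrite /p expr0n /= mulr0; lra.
have fg : \forall t \near 0, is_derive (t : R) (1 : R) f (g t).
  near=> t; have pt : 0 < p t by near: t.
  have dp : is_derive (t : R) (1 : R) p (2 * t - 2 * a).
    apply: is_derive_eq; rewrite /GRing.scale /=; ring.
  have dq := @is_derive1_powR R (- 2^-1) (p t) pt.
  exact: (@is_derive1_comp R (fun x => x `^ (- 2^-1)) p t _ _ dq dp).
have dcg := sums_near0_derive cf fg.
have ode : \forall t \near 0,
    p t * g t - (a - t) * f t = 0.
  near=> t; have pt : 0 < p t by near: t.
  (* One factor p is split off so that f and g share the power of exponent -3/2; what remains is
     polynomial. *)
  have -> : f t = p t * p t `^ (- 2^-1 - 1).
    rewrite -[X in X * _](@powRr1 _ (p t)) ?ltW // -powRD.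
      by rewrite addrC subrK.
    by apply/implyP => _; rewrite gt_eqF.
  by rewrite /g; field.
pose dc := pseries_diffs c.
(* The coefficients of [(1 - 2 a t + t ^ 2) f' - (a - t) f]. *)
have Z : sums_near0 (fun n => 1 * dc n + (- (2 * a) * shift_seq dc n
     + (1 * shift_seq (shift_seq dc) n + (- a * c n + shift_seq c n)))) (cst 0).
  have sd := sums_near0_shift dcg; have ssd := sums_near0_shift sd.
  have := sums_near0_comb 1 dcg (sums_near0_comb (- (2 * a)) sd
    (sums_near0_comb 1 ssd (sums_near0_comb (- a) cf (sums_near0_shift cf)))).
  apply: sums_near0_eq; near=> t.
  have <- : p t * g t - (a - t) * f t = 0 by near: t.
  by rewrite /= /p; ring.
have rec := sums_near0_unique Z.
have c0 : c 0 = 1.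
  by rewrite (sums_near0_at0 cf) /f mulr0 subr0 expr0n addr0 powR1.
split=> //.
- by have := rec 0; rewrite /dc /pseries_diffs /= c0; lra.
(* The twice-shifted sequence is 0 at index 1, so n = 0 is read off at coefficient 1 and n + 1 at
   coefficient n + 2. *)
- move=> [|n]; [have := rec 1 | have := rec n.+2];
    rewrite /dc /pseries_diffs /= => h; apply/eqP; rewrite -subr_eq0;
    apply/eqP; rewrite -[RHS]h; ring.
Unshelve. all: by end_near. Qed.

End LegendreSeries.

(** The difference vanishes at the distinct points 1/(i+1), as many as its size. *)
Lemma poly_eq_on_symmetric_segment (F : numFieldType) (p q : {poly F}) :
  (forall x, -1 <= x <= 1 -> p.[x] = q.[x]) -> p = q.
Proof.
move=> pq; apply/eqP; rewrite -subr_eq0; apply/eqP.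
pose rs := [seq (i.+1%:R)^-1 : F | i <- iota 0 (size (p - q))].
apply: (@roots_geq_poly_eq0 _ _ rs).
- apply/allP => _ /mapP[i _ ->]; rewrite rootE !hornerE pq ?subrr //.
  have i0 : 0 < (i.+1%:R : F)^-1 by rewrite invr_gt0 ltr0n.
  rewrite (le_trans _ (ltW i0)) ?lerN10 //=.
  by rewrite invf_le1 ?ler1n ?ltr0n.
- rewrite map_inj_uniq ?iota_uniq // => i j /invr_inj/eqP.
  by rewrite eqr_nat eqSS => /eqP.
- by rewrite size_map size_iota.
Qed.

(** * Legendre polynomials and their integrals *)

Section LegendreFamily.
Variables (R : realType) (P : nat -> {poly R}).
Hypothesis PL : legendre_family P.

Lemma legendre_family_recurrence :
  [/\ P 0 = 1, P 1 = 'X & forall n,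
    n.+2%:R * P n.+2 = (2 * n + 3)%:R * 'X * P n.+1 - n.+1%:R * P n].
Proof.
have rec a (ha : -1 <= a <= 1) := legendre_series_recurrence (PL ha).
split=> [||n]; apply: poly_eq_on_symmetric_segment => a ha;
  have [c0 c1 cn] := rec a ha.
- by rewrite c0 hornerE.
- by rewrite c1 hornerE.
- by rewrite -!polyC_natr !hornerE cn.
Qed.

Lemma integral_poly (p : {poly R}) :
  (\int[lebesgue_measure]_(x in `[(-1)%R, 1%R]) (p.[x])%:E = (symint p)%:E)%E.
Proof.
rewrite (@continuous_FTC2 _ _ (horner (prim p))) -?EFinB //.
- by apply/continuous_subspaceT => x; exact: continuous_horner.
- split=> [x _||].
  + exact: derivable_horner.
  + by apply: cvg_at_right_filter; exact: continuous_horner.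
  + by apply: cvg_at_left_filter; exact: continuous_horner.
- by move=> x _; rewrite -derivE deriv_prim.
Qed.

Lemma legendre_family_norm n :
  (\int[lebesgue_measure]_(x in `[(-1)%R, 1%R]) ((P n).[x] ^+ 2)%:E =
     (2 / (2 * n%:R + 1))%:E)%E.
Proof.
have [P0 P1 Prec] := legendre_family_recurrence.
rewrite -(legendre_norm P0 P1 Prec) -integral_poly.
by apply: eq_integral => x _; rewrite horner_exp.
Qed.

End LegendreFamily.

Theorem theorem3p7 (R : realType) (w1 : R) (w1_gt0 : 0 < w1)
    (phi : {scalar heis0 R})
    (omega : uea w1 -> uea w1) (omegaP : heis_antiautomorphism omega)
    (S : verma w1 phi -> verma w1 phi -> R[i])
    (SP : shapovalov_form omega S) (Sreg : shapovalov_regular S)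
    (mu : nat -> verma w1 phi -> R[i])
    (muP : forall n, partition_functional n (mu n)) :
  let q := level w1 phi in
  let binom n := gbinom (q^-1 + n%:R - 1) n in
  let kstar n := sqrtC (2 / (2 * n%:R + 1)) * (sqrtC (binom n))^-1 in
  [/\ (* (i) *)
      forall n (kappa : R[i]), kappa != 0 ->
        exists P, [/\ represents S (mu n) n kappa P,
          forall P', represents S (mu n) n kappa P' -> P' = P
        & exists2 kappa', kappa' != 0 & P = ptilde w1 phi n kappa'],
      (* (ii) *)
      forall n n' (kappa kappa' : R[i]) P P', n <> n' -> kappa != 0 -> kappa' != 0 ->
        represents S (mu n) n kappa P -> represents S (mu n') n' kappa' P' ->
        S P P' = 0,
      (* (iii) *)
      forall n,
        [/\ S (ptilde w1 phi n 1) (ptilde w1 phi n 1) =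
              \sum_(l : partition_of n)
                 ((zpart (parts l))%:R * q ^+ lenpart (parts l))^-1,
            \sum_(l : partition_of n)
               ((zpart (parts l))%:R * q ^+ lenpart (parts l))^-1 = binom n
          & binom n = (n`!%:R)^-1 * \prod_(1 <= j < n) (1 + j%:R * q) * q ^- n]
    & (* (iv) *)
      (0 < q ->
        (forall n, (1 <= n)%N -> 0 < kstar n) /\
        forall kap : nat -> R[i], (forall n, (1 <= n)%N -> 0 < kap n) ->
          (forall n n', (1 <= n)%N -> (1 <= n')%N ->
             S (ptilde w1 phi n (kap n)) (ptilde w1 phi n' (kap n'))
               = 2 / (2 * n%:R + 1) * (n == n')%:R)
          <-> (forall n, (1 <= n)%N -> kap n = kstar n)) /\
      (forall P : nat -> {poly R}, legendre_family P ->
         forall n, (1 <= n)%N ->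
           (\int[lebesgue_measure]_(x in `[(-1)%R, 1%R]) ((P n).[x] ^+ 2)%:E =
              (2 / (2 * n%:R + 1))%:E)%E)].

Proof.
move=> q binom kstar.
have q0 : q != 0 := shapovalov_regular_level_neq0 omegaP SP Sreg.
(* Representing vectors are exactly the [ptilde], so (i) and (ii) become statements about these. *)
have repE n k P := represents_ptilde omegaP SP q0 k P (muP n).
have norm n k k' := shapovalov_ptilde omegaP SP q0 n k k'.
have orth := @shapovalov_ptilde_neq _ _ _ _ _ SP.
split=> [n k k0|n n' k k' P P' nn' _ _|n|].
- exists (ptilde w1 phi n k); split; first by apply/repE.
    by move=> P' /repE.
  by exists k.
- by move=> /repE -> /repE ->; apply: orth.
- have bE := sum_norm_part w1 phi n; split.
  + by rewrite norm !mul1r -bE.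
  + exact: bE.
  + exact: gbinom_inv.
split=> [q_gt0|P PL n _]; last exact: legendre_family_norm.
have d_gt0 n : 0 < 2 / (2 * n%:R + 1) :> R[i].
  by rewrite divr_gt0 // ltr_wpDl // mulr_ge0.
have b_gt0 n : 0 < binom n by apply: gbinom_gt0; rewrite invr_gt0.
have k_gt0 n : 0 < kstar n by rewrite mulr_gt0 ?invr_gt0 ?sqrtC_gt0.
have kE n : kstar n ^+ 2 * binom n = 2 / (2 * n%:R + 1).
  by rewrite exprMn exprVn !sqrtCK divfK // gt_eqF.
split=> [n _|kap kap_gt0]; first exact: k_gt0.
split=> [h n n1|h n n' n1 n1'].
(* Once the binomial is cancelled, [kap n] and [kstar n] have equal squares, and both are
   positive. *)
- have /eqP := h n n n1 n1; rewrite eqxx mulr1 norm -expr2 -kE.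
  have b0 : binom n != 0 by rewrite gt_eqF.
  rewrite (inj_eq (mulIf b0)).
  by rewrite eqrXn2 ?ltW ?kap_gt0 // => /eqP.
- have [<-|/eqP nn'] := eqVneq n n'; last by rewrite mulr0 orth.
  by rewrite mulr1 norm -expr2 h.
Qed.
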